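(* Let $\mathbb{K}$ be a field and let $L_1,\ldots,L_k$ be nonzero operators in $\mathbb{K}[x]\langle\partial\rangle$. Let $s=\operatorname{ord}(L_1)+\cdots+\operatorname{ord}(L_k)$ and $d=\max_{1\le i\le k}\deg_x(L_i)$. If $L=\operatorname{lclm}(L_1,\ldots,L_k)$, then $\deg_x(L)\le d\,(k(s+1)-s)$.
   Context: $\mathbb{K}(x)\langle\partial\rangle$ is the ring of differential operators with coefficients in $\mathbb{K}(x)$ and $\partial a=a\partial+\frac{da}{dx}$; $\mathbb{K}[x]\langle\partial\rangle$ is the subring with polynomial coefficients. Order is degree in $\partial$; $\deg_x$ of a nonzero operator in $\mathbb{K}[x]\langle\partial\rangle$ is the maximal degree in $x$ of its coefficients. An LCLM of $L_1,\ldots,L_k$ is a nonzero common left multiple $Q_1L_1=\cdots=Q_kL_k$ ($Q_i\in\mathbb{K}(x)\langle\partial\rangle$) of least order; $\operatorname{lclm}(L_1,\ldots,L_k)$ is the LCLM normalised to lie in $\mathbb{K}[x]\langle\partial\rangle$ with coefficients having gcd $1$. *)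

(* Defs.v *)
From HB Require Import structures.
From mathcomp Require Import all_boot all_order all_algebra.
From mathcomp Require Import fraction.
Set Implicit Arguments. Unset Strict Implicit. Unset Printing Implicit Defensive.
Import Order.TTheory GRing.Theory Num.Theory.
Local Open Scope ring_scope.

(* Differential operators with coefficients in a commutative ring R equipped
   with a derivation [der] are represented as elements of {poly R}:
   the polynomial  \sum_i a_i 'X^i  stands for the operator \sum_i a_i \partial^i.
   Only the additive structure of {poly R} is used; the (non-commutative)
   operator product is [opmul], defined by the Leibniz rule
   (a \partial^i)(b \partial^j) = \sum_l C(i,l) a b^{(l)} \partial^(i+j-l). *)
Definition opmul (R : comNzRingType) (der : R -> R) (P Q : {poly R}) : {poly R} :=
  \sum_(i < size P) \sum_(j < size Q) \sum_(l < i.+1)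
     (P`_i * ('C(i, l))%:R * iter l der (Q`_j)) *: 'X^(i + j - l).

Definition opord (R : comNzRingType) (P : {poly R}) : nat := (size P).-1.

(* K[x]<\partial> : R = {poly K} with der = formal derivative d/dx *)
Notation polyop K := {poly {poly K}}.

Definition degx (K : fieldType) (P : polyop K) : nat :=
  (\max_(i < size P) (size (nth 0%R P i)).-1)%N.

Definition fracder (K : fieldType) (f : {fraction {poly K}}) : {fraction {poly K}} :=
  let r := repr f in
  let n := (frac r).1 in let d := (frac r).2 in
  tofrac (n^`() * d - n * d^`()) / tofrac (d ^+ 2).

Notation ratop K := {poly {fraction {poly K}}}.

Definition ratmul (K : fieldType) (P Q : ratop K) : ratop K :=
  opmul (@fracder K) P Q.

Definition embop (K : fieldType) (P : polyop K) : ratop K :=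
  map_poly (@tofrac _) P.

Definition is_clm (K : fieldType) (k : nat) (L : 'I_k -> polyop K) (M : ratop K) :=
  forall i : 'I_k, exists Q : ratop K, ratmul Q (embop (L i)) = M.

Definition is_LCLM (K : fieldType) (k : nat) (L : 'I_k -> polyop K) (M : ratop K) :=
  [/\ M != 0, is_clm L M &
      forall M' : ratop K, M' != 0 -> is_clm L M' -> (opord M <= opord M')%N].

Definition is_lclm (K : fieldType) (k : nat) (L : 'I_k -> polyop K) (M : polyop K) :=
  is_LCLM L (embop M) /\ (\big[@gcdp _/0]_(i < size M) M`_i %= 1).

(* Main.v *)
(* Let [r] be the order of the LCLM and [r_i] that of [L_i].  The equations
   [Q_i L_i = W], for [i = 1..k] and [ord W <= r], form a linear system over K[x]
   whose unknowns are the coefficients of the [Q_i] and of [W]; those of [Q_i]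
   carry coefficients [\partial^j L_i] of degree at most [d], while those of [W]
   carry coefficients 0 and -1.  By minimality of [r] the solutions over K(x) form a
   line, so Cramer's rule provides a polynomial solution in which [W] has degree at
   most [d] times the number [k(r + 1) - s] of unknowns of the first kind.
   As [M] is primitive, this [W] is a polynomial multiple of [M].  Finally [r <= s], as
   for [r = s] the system has more unknowns than equations. *)
Require Import Defs.
From mathcomp Require Import all_boot all_order all_algebra.
From mathcomp Require Import fraction generic_quotient perm.
From mathcomp Require Import zify ring.
Import Order.TTheory GRing.Theory Num.Theory.
Set Implicit Arguments. Unset Strict Implicit. Unset Printing Implicit Defensive.
Local Open Scope quotient_scope.
Local Open Scope ring_scope.

(** * Products of operators and their order *)

(* The operator [\partial^i Q]. *)
Definition dpow (R : comNzRingType) (der : R -> R) (i : nat) (Q : {poly R}) :=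
  \sum_(j < size Q) \sum_(l < i.+1)
     (('C(i, l))%:R * iter l der Q`_j) *: 'X^(i + j - l).

(** Leaving [n] free lets operators of different orders be expanded over one common range. *)
Lemma opmulE (R : comNzRingType) (der : R -> R) n (P Q : {poly R}) :
  (size P <= n)%N -> opmul der P Q = \sum_(i < n) P`_i *: dpow der i Q.
Proof.
move=> lePn; transitivity (\sum_(i < size P) P`_i *: dpow der i Q).
  apply: eq_bigr => i _; rewrite scaler_sumr; apply: eq_bigr => j _.
  by rewrite scaler_sumr; apply: eq_bigr => l _; rewrite scalerA mulrA.
rewrite (big_ord_widen n (fun i => P`_i *: dpow der i Q) lePn) big_mkcond /=.
apply: eq_bigr => i _; case: ltnP => // leP.
by rewrite nth_default // scale0r.
Qed.

Lemma opmul_lin (R : comNzRingType) (der : R -> R) (c : R) (P P' Q : {poly R}) :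
  opmul der (c *: P + P') Q = c *: opmul der P Q + opmul der P' Q.
Proof.
set n := maxn (size (c *: P + P')) (maxn (size P) (size P')).
rewrite !(@opmulE _ _ n) ?leq_max ?leqnn ?orbT // scaler_sumr -big_split /=.
by apply: eq_bigr => i _; rewrite coefD coefZ scalerDl scalerA.
Qed.

Lemma size_dpow_le (R : comNzRingType) (der : R -> R) i (Q : {poly R}) :
  (size (dpow der i Q) <= i + size Q)%N.
Proof.
apply: (leq_trans (size_sum _ _ _)); apply/bigmax_leqP => j _.
apply: (leq_trans (size_sum _ _ _)); apply/bigmax_leqP => l _.
apply: (leq_trans (size_scale_leq _ _)); rewrite size_polyXn.
by have := ltn_ord j; lia.
Qed.

(** The exponent [i + j - l] reaches its maximum only for the top [j] and [l = 0], where [Q] is not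
    differentiated. *)
Lemma coef_dpow_lead (R : comNzRingType) (der : R -> R) i (Q : {poly R}) :
  (dpow der i Q)`_(i + (size Q).-1) = lead_coef Q.
Proof.
have [->|Q0] := eqVneq Q 0.
  by rewrite /dpow size_poly0 big_ord0 coef0 lead_coef0.
have sQ : ((size Q).-1 < size Q)%N by rewrite prednK // size_poly_gt0.
rewrite coef_sum (bigD1 (Ordinal sQ)) //= big_ord_recl coefD /= subn0.
rewrite bin0 mul1r coefZ coefXn eqxx mulr1 coef_sum !big1 ?addr0 //.
  move=> j neqj; rewrite coef_sum big1 // => l _.
  rewrite coefZ coefXn [_ == _]negbTE ?mulr0 //.
  have : (j < (size Q).-1)%N.
    rewrite ltn_neqAle -ltnS prednK ?size_poly_gt0 // ltn_ord andbT.
    by apply: contraNneq neqj => e; apply/eqP/val_inj.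
  by move: (_.-1) => q; lia.
move=> l _; rewrite coefZ coefXn [_ == _]negbTE ?mulr0 //.
by rewrite /= /bump; have := ltn_ord l; lia.
Qed.

(** The summand of highest index in [opmulE] has strictly larger order than the others, and its
    leading coefficient is a product of nonzero elements of a domain. *)
Lemma size_opmul (R : idomainType) (der : R -> R) (P Q : {poly R}) :
  P != 0 -> Q != 0 -> size (opmul der P Q) = (size P + size Q).-1%N.
Proof.
move=> P0 Q0; have sP := polySpred P0; have sQ := polySpred Q0.
rewrite (opmulE _ _ (leqnn _)) sP big_ord_recr /=; set n := (size P).-1.
have lt: (size (\sum_(i < n) P`_i *: dpow der i Q)%R <= n + (size Q).-1)%N.
  apply: (leq_trans (size_sum _ _ _)); apply/bigmax_leqP => i _.
  apply: (leq_trans (size_scale_leq _ _)).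
  apply: (leq_trans (size_dpow_le _ _ _)).
  by rewrite -ltnS -[ltnRHS]addnS prednK ?size_poly_gt0 // ltn_add2r.
have sz: size (P`_n *: dpow der n Q) = (n + size Q)%N.
  rewrite size_scale -?lead_coefE ?lead_coef_eq0 //.
  apply/eqP; rewrite eqn_leq size_dpow_le /= sQ addnS.
  rewrite ltnNge; apply: contraNN Q0 => le.
  by rewrite -lead_coef_eq0 -(coef_dpow_lead der n) nth_default.
by rewrite addrC size_polyDl ?sz // sQ addnS ltnS.
Qed.

(** * The derivation of K(x) and the embedding of K[x]<\partial> *)

(** The chosen representative n/d of [p] may have d different from 1; but n = p d, so the quotient
    rule has numerator p' d^2. *)
Lemma fracder_tofrac (K : fieldType) (p : {poly K}) :
  fracder (tofrac p) = tofrac p^`().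
Proof.
rewrite /fracder; set r := repr _; set n := (frac r).1; set d := (frac r).2.
have d0 : d != 0 by exact: denom_ratioP.
have nE : n = p * d.
  have := FracField.equivf_l (Ratio p 1).
  have <- : tofrac p = \pi_{fraction {poly K}} (Ratio p 1) by unlock tofrac.
  by rewrite -/r -/n -/d !numden_Ratio ?oner_neq0 // mulr1 mulrC => ->; rewrite mulrC.
have -> : n^`() * d - n * d^`() = p^`() * d ^+ 2.
  by rewrite nE derivM; ring.
by rewrite rmorphM /= mulfK // tofrac_eq0 expf_neq0.
Qed.

Lemma iter_fracder (K : fieldType) l (p : {poly K}) :
  iter l (@fracder K) (tofrac p) = tofrac (iter l (@deriv K) p).
Proof. by elim: l => //= l ->; rewrite fracder_tofrac. Qed.

Lemma coef_embop (K : fieldType) (P : {poly {poly K}}) i :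
  (embop P)`_i = tofrac P`_i.
Proof. by rewrite coef_map. Qed.

Lemma size_embop (K : fieldType) (P : {poly {poly K}}) :
  size (embop P) = size P.
Proof.
by rewrite size_map_inj_poly ?rmorph0 // => p q /eqP; rewrite tofrac_eq => /eqP.
Qed.

Lemma embop_eq0 (K : fieldType) (P : {poly {poly K}}) :
  (embop P == 0) = (P == 0).
Proof. by rewrite -!size_poly_eq0 size_embop. Qed.

Lemma dpow_embop (K : fieldType) i (P : {poly {poly K}}) :
  dpow (@fracder K) i (embop P) = embop (dpow (@deriv K) i P).
Proof.
rewrite /dpow size_embop /embop rmorph_sum; apply: eq_bigr => j _.
rewrite rmorph_sum; apply: eq_bigr => l _.
apply/polyP=> m; rewrite coefZ !coef_map /= coefZ !coefXn .
by rewrite !rmorphM /= !rmorph_nat iter_fracder.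
Qed.

(** * Degrees in x of coefficients and determinants *)

Lemma size_coef_degx (K : fieldType) (P : {poly {poly K}}) i :
  (size (P`_i)%R <= (degx P).+1)%N.
Proof.
have [lt|ge] := ltnP i (size P); last by rewrite nth_default ?size_poly0.
have := leq_bigmax (F := fun i : 'I_(size P) => (size (P`_i)%R).-1) (Ordinal lt).
by rewrite /degx /=; lia.
Qed.

(** Left multiplication by \partial only shifts and differentiates coefficients, which never raises
    the degree in x. *)
Lemma size_coef_dpow (K : fieldType) n i (P : {poly {poly K}}) m :
  (forall j, size (P`_j)%R <= n)%N -> (size ((dpow (@deriv K) i P)`_m)%R <= n)%N.
Proof.
move=> leP; rewrite coef_sum; apply: (leq_trans (size_sum _ _ _)).
apply/bigmax_leqP => j _; rewrite coef_sum; apply: (leq_trans (size_sum _ _ _)).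
apply/bigmax_leqP => l _; rewrite coefZ coefXn mulr_natr mulr_natl.
have leMn (p : {poly K}) c : (size (p *+ c) <= size p)%N.
  by rewrite -scaler_nat size_scale_leq.
do 2 apply: (leq_trans (leMn _ _)).
elim: (val l) => //= l' IH; apply: leq_trans IH.
by rewrite (leq_trans (size_poly _ _)) ?leq_pred.
Qed.

(** Each term of the Leibniz formula takes one entry from every row. *)
Lemma size_det_le (K : fieldType) n (A : 'M[{poly K}]_n) (e : 'I_n -> nat) :
  (forall i j, size (A i j) <= (e i).+1)%N ->
  (size (\det A) <= (\sum_i e i).+1)%N.
Proof.
move=> leA; apply: (leq_trans (size_sum _ _ _)); apply/bigmax_leqP => s _.
rewrite -signr_odd mulr_sign.
have le : (size (\prod_i A i (s i))%R <= (\sum_i e i).+1)%N.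
  elim/big_rec2: _ => [|i x y _ IH]; first by rewrite size_poly1.
  apply: (leq_trans (size_polyMleq _ _)).
  by have := leA i (s i); move: IH; lia.
by case: ifP; rewrite ?size_polyN.
Qed.

(** * Polynomial generators of one-dimensional kernels *)

Lemma rank_ker1 (F : fieldType) n m (A : 'M[F]_(n.+1, m)) (u0 : 'rV_n.+1) :
  u0 != 0 -> u0 *m A = 0 ->
  (forall u : 'rV_n.+1, u *m A = 0 -> exists c, u = c *: u0) -> \rank A = n.
Proof.
move=> u0N0 u0A ker1.
have : (u0 <= kermx A)%MS by apply/sub_kermxP.
move/mxrankS; rewrite rank_rV u0N0 mxrank_ker => ge.
have : (kermx A <= u0)%MS.
  apply/row_subP => i; have /ker1[c ->] : row i (kermx A) *m A = 0.
    by rewrite -row_mul mulmx_ker row0.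
  exact: scalemx_sub.
by move/mxrankS; rewrite rank_rV u0N0 mxrank_ker; have := rank_leq_row A; lia.
Qed.

(* The entries of [v] are the maximal minors of [n] columns of [A] (with [n + 1] the
   number of rows) having the same left kernel as [A]; [e] bounds the degrees of the
   rows. *)
Lemma poly_kernel_mx (K : fieldType) n m (A : 'M[{poly K}]_(n, m)) (e : 'I_n -> nat)
    (u0 : 'rV[{fraction {poly K}}]_n) :
  (forall i j, size (A i j) <= (e i).+1)%N ->
  u0 != 0 -> u0 *m map_mx (@tofrac _) A = 0 ->
  (forall u : 'rV_n, u *m map_mx (@tofrac _) A = 0 -> exists c, u = c *: u0) ->
  exists v : 'rV[{poly K}]_n, [/\ v != 0, v *m A = 0 &
    forall i, (size (v 0%R i) <= (\sum_(j | j != i) e j).+1)%N].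
Proof.
case: n A e u0 => [|n] A e u0 leA u0N0 u0A ker1.
  by rewrite thinmx0 eqxx in u0N0.
set A' := map_mx _ A in u0A ker1.
have rkA : \rank A' = n by exact: rank_ker1 u0N0 u0A ker1.
(* As the rank is [n], some [n] columns span the column space. *)
have [f fP] : exists f : 'I_n -> 'I_m, (A'^T <= rowsub f A'^T)%MS.
  have := eq_maxrowsub A'^T; move: (maxrankfun _).
  by rewrite mxrank_tr rkA => f fE; exists f; rewrite fE.
pose B := colsub f A.
have kerB (u : 'rV_n.+1) : u *m map_mx (@tofrac _) B = 0 -> u *m A' = 0.
  have /submxP[D DE] := fP.
  have -> : map_mx (@tofrac _) B = (rowsub f A'^T)^T by apply/matrixP=> i j; rewrite !mxE.
  by move=> uB; rewrite -[A']trmxK DE trmx_mul mulmxA uB mul0mx.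
(* A column [c] put before [B] gives a square matrix whose cofactors along that column do not depend
   on [c]; they form [v]. *)
pose C c : 'M[{poly K}]_(1 + n) := row_mx c B.
pose v : 'rV[{poly K}]_n.+1 := \row_i cofactor (C 0) i 0.
have vE c i : cofactor (C c) i 0 = v 0 i.
  rewrite mxE /cofactor; congr (_ * \det _); apply/matrixP=> a b.
  by rewrite !mxE; case: splitP => // z; rewrite ord1.
have vB : v *m B = 0.
  have : \adj (C 0) *m C 0 = 0.
    (* The determinant of [C 0] vanishes, its first column being zero. *)
    rewrite mul_adj_mx (expand_det_col _ 0) big1 ?raddf0 // => i _.
    by rewrite mxE; case: splitP => // z _; rewrite mxE mul0r.
  move/(congr1 (row 0)); rewrite row_mul row0.
  have -> : row 0 (\adj (C 0)) = v by apply/rowP => i; rewrite !mxE.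
  by rewrite mul_mx_row -(row_mx0 _ _ _ n) => /eq_row_mx[].
have vA' : map_mx (@tofrac _) v *m A' = 0.
  by apply: kerB; rewrite -map_mxM vB map_mx0.
exists v; split.
(* The entry of [v] at [i] is the determinant of [C] with the unit column at [i]. Were it zero, a
   nonzero [w] would satisfy w B = 0 and w_i = 0; then w = c u0 with c u0_i = 0, forcing w = 0. *)
- have /rV0Pn[i u0i] := u0N0.
  apply/rV0Pn; exists i; rewrite -(vE (delta_mx i 0)).
  have -> : cofactor (C (delta_mx i 0)) i 0 = \det (C (delta_mx i 0)).
    rewrite (expand_det_col _ 0) (bigD1 i) //= big1 ?addr0.
      by rewrite mxE; case: splitP => // z _; rewrite ord1 mxE !eqxx mul1r.
    move=> j ji; rewrite mxE; case: splitP => // z _.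
    by rewrite ord1 mxE (negbTE ji) mul0r.
  rewrite -tofrac_eq0 -det_map_mx; apply/negP => /det0P[w w0].
  rewrite map_row_mx mul_mx_row -(row_mx0 _ _ _ n) => /eq_row_mx[wi /kerB /ker1[c wE]].
  move: wi; rewrite map_delta_mx -colE => /(congr1 (fun z : 'M_1 => z 0 0)).
  rewrite wE !mxE => /eqP; rewrite mulf_eq0 (negbTE u0i) orbF => /eqP c0.
  by rewrite wE c0 scale0r eqxx in w0.
- apply/matrixP => a b; apply/eqP; rewrite -tofrac_eq; apply/eqP.
  by have /matrixP/(_ a b) := vA'; rewrite -map_mxM !mxE tofrac0.
move=> i; rewrite mxE /cofactor -signr_odd mulr_sign.
have : (size (\det (row' i (col' 0%R (C 0%R))))%R <= (\sum_(j < n) e (lift i j)).+1)%N.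
  apply: size_det_le => a b; rewrite !mxE.
  by case: splitP => z _; rewrite mxE ?size_poly0 ?leA.
have -> : (\sum_(j < n) e (lift i j) = \sum_(j | j != i) e j)%N.
  apply: (@addnI (e i)); rewrite -(bigD1 (op := addn) i (P := predT) (F := e)) //.
  by rewrite (bigD1_ord i).
by case: ifP; rewrite ?size_polyN.
Qed.

(** * Linear systems indexed by arbitrary finite types *)

Lemma size_opord (R : comNzRingType) (P : {poly R}) : P != 0 -> size P = (opord P).+1.
Proof. exact: polySpred. Qed.

Definition fun_mx (R : nzRingType) (I J : finType) (a : I -> J -> R) :=
  \matrix_(i < #|I|, j < #|J|) a (enum_val i) (enum_val j).

Definition fun_rV (R : nzRingType) (I : finType) (u : I -> R) :=
  \row_(i < #|I|) u (enum_val i).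

Lemma fun_rV_rank (R : nzRingType) (I : finType) (u : 'rV[R]_#|I|) :
  u = fun_rV (fun x => u 0 (enum_rank x)).
Proof. by apply/rowP => i; rewrite mxE enum_valK. Qed.

Lemma fun_rV_ker (R : nzRingType) (I J : finType) (a : I -> J -> R) (u : I -> R) :
  fun_rV u *m fun_mx a = 0 <-> forall y, \sum_x u x * a x y = 0.
Proof.
have E y : (fun_rV u *m fun_mx a) 0 (enum_rank y) = \sum_x u x * a x y.
  rewrite mxE (big_enum_val (A := I) (fun x => u x * a x y)) /=.
  by apply: eq_bigr => i _; rewrite !mxE enum_rankK.
split=> [u0 y|u0]; first by rewrite -E u0 mxE.
by apply/rowP => j; rewrite -[j]enum_valK E u0 mxE.
Qed.

Lemma fun_rV_neq0 (R : nzRingType) (I : finType) (u : I -> R) :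
  fun_rV u != 0 <-> exists x, u x != 0.
Proof.
split=> [/rV0Pn[i ui]|[x ux]]; first by exists (enum_val i); rewrite mxE in ui.
by apply/rV0Pn; exists (enum_rank x); rewrite mxE enum_rankK.
Qed.

Lemma kernel_exists (F : fieldType) (I J : finType) (a : I -> J -> F) :
  (#|J| < #|I|)%N ->
  exists u : I -> F, (exists x, u x != 0) /\ forall y, \sum_x u x * a x y = 0.
Proof.
move=> lt; have : kermx (fun_mx a) != 0.
  by rewrite -mxrank_eq0 mxrank_ker; have := rank_leq_col (fun_mx a); lia.
case/rowV0Pn => u /sub_kermxP; rewrite (fun_rV_rank u) => /fun_rV_ker ua /fun_rV_neq0 u0.
by exists (fun x => u 0 (enum_rank x)).
Qed.

Lemma poly_kernel (K : fieldType) (I J : finType) (a : I -> J -> {poly K})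
    (e : I -> nat) (u0 : I -> {fraction {poly K}}) :
  (forall x y, size (a x y) <= (e x).+1)%N ->
  (exists x, u0 x != 0) -> (forall y, \sum_x u0 x * tofrac (a x y) = 0) ->
  (forall u : I -> {fraction {poly K}}, (forall y, \sum_x u x * tofrac (a x y) = 0) ->
     exists c, forall x, u x = c * u0 x) ->
  exists v : I -> {poly K}, [/\ exists x, v x != 0,
    forall y, \sum_x v x * a x y = 0 &
    forall x, (size (v x) <= (\sum_(z | z != x) e z).+1)%N].
Proof.
move=> lea u0N0 u0a ker1.
have mapE : map_mx (@tofrac _) (fun_mx a) = fun_mx (fun x y => tofrac (a x y)).
  by apply/matrixP => i j; rewrite !mxE.
have [||||v [vN0 va lev]] :=
    @poly_kernel_mx K _ _ (fun_mx a) (fun i => e (enum_val i)) (fun_rV u0).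
- by move=> i j; rewrite mxE.
- exact/fun_rV_neq0.
- by rewrite mapE; apply/fun_rV_ker.
- move=> u; rewrite mapE (fun_rV_rank u) => /fun_rV_ker /ker1[c uE]; exists c.
  by apply/rowP => i; rewrite !mxE uE.
rewrite (fun_rV_rank v) in va vN0.
exists (fun x => v 0 (enum_rank x)); split.
- exact/fun_rV_neq0.
- exact/fun_rV_ker.
move=> x; apply: (leq_trans (lev _)); rewrite ltnS big_mkcond [leqRHS]big_mkcond /=.
rewrite (big_enum_val (A := I) (fun z => if z != x then e z else 0%N)) /= leq_eqVlt.
apply/orP; left; apply/eqP; apply: eq_bigr => i _.
by rewrite (can2_eq (@enum_valK _) (@enum_rankK _)).
Qed.

(** * The linear system of common left multiples *)

(* The equations [Q_i L_i = W] with [ord W <= r], for all [i], as a linear system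
   in the coefficients of the [Q_i] (left summand) and of [W] (right summand). *)
Definition clm_unknown (K : fieldType) k (L : 'I_k -> {poly {poly K}}) r : finType :=
  ({i : 'I_k & 'I_(r.+1 - opord (L i))} + 'I_r.+1)%type.

(** The column of (i, m) expresses the coefficient of \partial^m in Q_i L_i - W, so solutions are
    left kernel vectors. *)
Definition clm_coef (K : fieldType) k (L : 'I_k -> {poly {poly K}}) r
    (x : clm_unknown L r) (y : 'I_k * 'I_r.+1) : {poly K} :=
  match x with
  | inl t => if tag t == y.1 then (dpow (@deriv K) (tagged t) (L y.1))`_y.2 else 0
  | inr m => if m == y.2 then -1 else 0
  end.

Definition left_factor_idx (K : fieldType) k (L : 'I_k -> {poly {poly K}}) r (i : 'I_k)
    (j : 'I_(r.+1 - opord (L i))) : clm_unknown L r :=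
  inl (Tagged (fun i => 'I_(r.+1 - opord (L i))) j).

Definition left_factor (K : fieldType) k (L : 'I_k -> {poly {poly K}}) r
    (u : clm_unknown L r -> {fraction {poly K}}) (i : 'I_k) : ratop K :=
  rVpoly (\row_(j < r.+1 - opord (L i)) u (left_factor_idx j)).

Definition multiple_of (K : fieldType) k (L : 'I_k -> {poly {poly K}}) r
    (u : clm_unknown L r -> {fraction {poly K}}) : ratop K :=
  rVpoly (\row_m u (inr m)).

Lemma clm_system (K : fieldType) k (L : 'I_k -> {poly {poly K}}) r
    (u : clm_unknown L r -> {fraction {poly K}}) :
  (forall i, L i != 0) ->
  (forall y, \sum_x u x * tofrac (clm_coef x y) = 0) <->
  (forall i, ratmul (left_factor u i) (embop (L i)) = multiple_of u).
Proof.
move=> L0.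
have mulE i : ratmul (left_factor u i) (embop (L i)) =
    \sum_(j < r.+1 - opord (L i))
       u (left_factor_idx j) *: embop (dpow (@deriv K) j (L i)).
  rewrite /ratmul (opmulE _ _ (size_poly _ _)); apply: eq_bigr => j _.
  by rewrite coef_rVpoly_ord mxE dpow_embop.
have sumE i m : \sum_x u x * tofrac (clm_coef x (i, m)) =
    (ratmul (left_factor u i) (embop (L i)))`_m - (multiple_of u)`_m.
  rewrite big_sumType /=; congr (_ + _).
    rewrite mulE coef_sum.
    transitivity (\sum_(i' < k) \sum_(j < r.+1 - opord (L i')) u (left_factor_idx j) *
        tofrac (if i' == i then (dpow (@deriv K) j (L i))`_m else 0)).
      by rewrite sig_big_dep; apply: eq_bigr => -[].
    rewrite (bigD1 i) //= [X in _ + X]big1 ?addr0 => [|i' /negbTE ->].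
      by apply: eq_bigr => j _; rewrite eqxx coefZ coef_embop.
    by apply: big1 => j _; rewrite tofrac0 mulr0.
  rewrite coef_rVpoly_ord mxE (bigD1 m) //= eqxx tofracN tofrac1 mulrN1 big1 ?addr0 //.
  by move=> m' /negbTE ->; rewrite tofrac0 mulr0.
split=> [eqs i|eqs [i m]]; last by rewrite sumE eqs subrr.
apply/polyP => m; have [lt|ge] := ltnP m r.+1.
  by apply/eqP; rewrite -subr_eq0; have := eqs (i, Ordinal lt); rewrite sumE => ->.
(* Beyond \partial^r both sides vanish, since j + ord(L_i) <= r in every term. *)
rewrite [RHS]nth_default ?(leq_trans (size_poly _ _)) // mulE coef_sum big1 // => j _.
rewrite coefZ coef_embop nth_default ?tofrac0 ?mulr0 //.
apply: leq_trans ge; apply: (leq_trans (size_dpow_le _ _ _)).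
by rewrite size_opord //; have := ltn_ord j; lia.
Qed.
Lemma size_ratmul (K : fieldType) (Q : ratop K) (P : {poly {poly K}}) :
  Q != 0 -> P != 0 -> size (ratmul Q (embop P)) = (size Q + opord P)%N.
Proof. by move=> Q0 P0; rewrite size_opmul ?embop_eq0 // size_embop (size_opord P0) addnS. Qed.

Lemma ratmul_eq0 (K : fieldType) (Q : ratop K) (P : {poly {poly K}}) :
  P != 0 -> ratmul Q (embop P) = 0 -> Q = 0.
Proof.
move=> P0 /eqP QP0; apply/eqP; apply: contraTT QP0 => Q0.
by rewrite -size_poly_gt0 size_ratmul // addn_gt0 size_poly_gt0 Q0.
Qed.

Lemma opord_clm_ge (K : fieldType) k (L : 'I_k -> {poly {poly K}}) (M : ratop K) i :
  L i != 0 -> M != 0 -> is_clm L M -> (opord (L i) <= opord M)%N.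
Proof.
move=> Li0 M0 /(_ i)[Q QE].
have Q0 : Q != 0.
  by apply: contraNneq M0 => Q0; rewrite -QE Q0 /ratmul /opmul size_poly0 big_ord0.
by have := size_ratmul Q0 Li0; rewrite QE !size_opord // addSn => -[->]; apply: leq_addl.
Qed.

(** As K(x)<\partial> has no zero divisors, W = 0 forces every Q_i to be zero. *)
Lemma clm_system_inj (K : fieldType) k (L : 'I_k -> {poly {poly K}}) r
    (u : clm_unknown L r -> {fraction {poly K}}) :
  (forall i, L i != 0) ->
  (forall i, ratmul (left_factor u i) (embop (L i)) = multiple_of u) ->
  multiple_of u = 0 -> forall x, u x = 0.
Proof.
move=> L0 eqs W0 [[i j]|m].
  have := eqs i; rewrite W0 => /(ratmul_eq0 (L0 i)) Q0.
  have := coef_rVpoly_ord (\row_(j < r.+1 - opord (L i)) u (left_factor_idx j)) j.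
  by rewrite mxE -/(left_factor u i) Q0 coef0.
have := coef_rVpoly_ord (\row_m u (inr m)) m.
by rewrite mxE -/(multiple_of u) W0 coef0.
Qed.

Lemma card_clm_unknown (K : fieldType) k (L : 'I_k -> {poly {poly K}}) r :
  (forall i, opord (L i) <= r)%N ->
  #|{: {i : 'I_k & 'I_(r.+1 - opord (L i))}}| =
    (k * (r + 1) - \sum_(i < k) opord (L i))%N.
Proof.
move=> ler; rewrite -sum1_card.
transitivity (\sum_(i < k) \sum_(j < r.+1 - opord (L i)) 1)%N.
  by rewrite sig_big_dep.
have -> : (k * (r + 1) = \sum_(i < k) (r + 1))%N by rewrite sum_nat_const card_ord.
rewrite -sumnB => [|i _]; first by apply: eq_bigr => i _; rewrite sum1_card card_ord addn1.
by have := ler i; lia.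
Qed.

(** For r = s there are k(s + 1) - s + (s + 1) unknowns, one more than the k(s + 1) equations; a
    nonzero solution has W nonzero by [clm_system_inj]. *)
Lemma exists_clm (K : fieldType) k (L : 'I_k -> {poly {poly K}}) :
  (forall i, L i != 0) ->
  exists M : ratop K, [/\ M != 0, is_clm L M & (opord M <= \sum_(i < k) opord (L i))%N].
Proof.
move=> L0; set s := (\sum_(i < k) _)%N.
have les i : (opord (L i) <= s)%N by rewrite /s (bigD1 i) //= leq_addr.
have [|u [[x ux] /(clm_system u L0) eqs]] :=
    @kernel_exists {fraction {poly K}} (clm_unknown L s) ('I_k * 'I_s.+1)%type
      (fun x y => tofrac (clm_coef x y)).
  rewrite card_sum card_clm_unknown // card_prod !card_ord -/s.
  (* This makes the truncated subtraction in the count exact; for k = 0 the sum [s] is 0. *)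
  have : (s <= k * s)%N.
    rewrite /s; case: (k) L {L0 s les} => [|k'] L; first by rewrite big_ord0.
    by rewrite leq_pmull.
  lia.
have W0 : multiple_of u != 0.
  by apply: contraNneq ux => W0; rewrite (clm_system_inj L0 eqs W0).
exists (multiple_of u); split=> // [i|]; first by exists (left_factor u i).
by rewrite -ltnS -(size_opord W0) size_poly.
Qed.

(** * The LCLM as a solution, unique up to a factor *)

Lemma clm_lin (K : fieldType) k (L : 'I_k -> {poly {poly K}}) c (M M' : ratop K) :
  is_clm L M -> is_clm L M' -> is_clm L (c *: M + M').
Proof.
by move=> h h' i; have [[Q <-] [Q' <-]] := (h i, h' i); exists (c *: Q + Q'); apply: opmul_lin.
Qed.

(* Minimality of the order: eliminating the leading coefficient leaves a common
   left multiple of smaller order, hence 0. *)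
Lemma LCLM_unique (K : fieldType) k (L : 'I_k -> {poly {poly K}}) (M W : ratop K) :
  is_LCLM L M -> is_clm L W -> (size W <= size M)%N -> exists c, W = c *: M.
Proof.
case=> M0 clmM minM clmW leW; exists (W`_(opord M) / lead_coef M); set c := _ / _.
apply/eqP; rewrite -subr_eq0 addrC -scaleNr; apply: contraT => D0.
suff : (size (- c *: M + W)%R <= opord M)%N.
  by rewrite (size_opord D0) ltnNge (minM _ D0 (clm_lin _ clmM clmW)).
apply/leq_sizeP => j; rewrite leq_eqVlt => /orP[/eqP <-|lt].
  by rewrite coefD coefZ -/(lead_coef M) mulNr divfK ?lead_coef_eq0 // addNr.
have leM : (size M <= j)%N by rewrite (size_opord M0).
by rewrite coefD coefZ !nth_default ?(leq_trans leW) // mulr0 addr0.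
Qed.

Lemma rVpoly_row (R : nzRingType) n (p : {poly R}) :
  (size p <= n)%N -> rVpoly (\row_(j < n) p`_j) = p.
Proof.
by move=> lepn; rewrite -[RHS](poly_rV_K lepn).
Qed.

Lemma is_clm_multiple (K : fieldType) k (L : 'I_k -> {poly {poly K}}) (M : ratop K) :
  (forall i, L i != 0) -> M != 0 -> is_clm L M ->
  exists u : clm_unknown L (opord M) -> {fraction {poly K}},
    multiple_of u = M /\ forall i, ratmul (left_factor u i) (embop (L i)) = M.
Proof.
move=> L0 M0 /fin_all_exists[Q QE]; set r := opord M.
pose u (x : clm_unknown L r) :=
  match x with inl t => (Q (tag t))`_(tagged t) | inr m => M`_m end.
exists u; split.
  by apply: rVpoly_row; rewrite size_opord.
move=> i; rewrite -[RHS](QE i); congr (ratmul _ _).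
(* Orders add up in Q_i L_i = M, so Q_i fits into the slots of the system. *)
have leQ : (size (Q i) <= r.+1 - opord (L i))%N.
  have [->|Q0] := eqVneq (Q i) 0; first by rewrite size_poly0.
  by rewrite -(size_opord M0) -(QE i) size_ratmul // addnK.
by rewrite -[RHS](rVpoly_row leQ).
Qed.

(** * Multiples of primitive operators *)

(** [b] divides the gcd of the a M_i, which is [a] times the content of [M]. *)
Lemma dvdp_mul_primitive (K : fieldType) (M : {poly {poly K}}) (a b : {poly K}) :
  \big[@gcdp _/0]_(i < size M) M`_i %= 1 ->
  (forall i, b %| a * M`_i) -> b %| a.
Proof.
move=> prim dvd; rewrite -[a]mulr1 -(eqp_dvdr _ (eqp_mull a prim)).
elim/big_rec: _ => [|i g _ IH]; first by rewrite mulr0 dvdp0.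
by rewrite (eqp_dvdr _ (mulp_gcdr _ _ _)) dvdp_gcd dvd.
Qed.

Lemma fractionE (R : idomainType) (c : {fraction R}) :
  exists a b : R, b != 0 /\ c = tofrac a / tofrac b.
Proof.
exists (frac (repr c)).1, (frac (repr c)).2; have d0 := denom_ratioP (repr c).
split=> //; rewrite -tofrac_eq0 in d0; apply: (mulIf d0); rewrite divfK //.
rewrite tofrac_eq0 in d0; rewrite -{1}[c]reprK; move: (repr c) d0 => x d0.
have tofracE y : tofrac y = \pi_{fraction R} (Ratio y 1) by unlock tofrac.
rewrite !tofracE -[LHS]FracField.pi_mul; apply/eqmodP.
rewrite /= FracField.equivfE /FracField.mulf !numden_Ratio ?oner_neq0 ?mulr1 //.
by rewrite mulrC.
Qed.

(** With c = a/b, primitivity of [M] gives b | a, so [c] is a nonzero polynomial and passing from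
    M_i to p_i cannot lower degrees. *)
Lemma degx_primitive_le (K : fieldType) (M : {poly {poly K}}) (p : nat -> {poly K}) c n :
  \big[@gcdp _/0]_(i < size M) M`_i %= 1 -> c != 0 ->
  (forall i, tofrac (p i) = c * tofrac M`_i) ->
  (forall i, (i < size M)%N -> (size (p i) <= n.+1)%N) -> (degx M <= n)%N.
Proof.
move=> prim c0 pE lep.
have [a [b [b0 cE]]] := fractionE c.
have a0 : a != 0 by apply: contraNneq c0 => a0; rewrite cE a0 tofrac0 mul0r.
have bp i : b * p i = a * M`_i.
  apply/eqP; rewrite -tofrac_eq !tofracM pE cE mulrA mulrCA divff ?mulr1 //.
  by rewrite tofrac_eq0.
have /dvdpP[q aE] : b %| a.
  by apply: (dvdp_mul_primitive prim) => i; rewrite -bp dvdp_mulr.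
have q0 : q != 0 by apply: contraNneq a0 => q0; rewrite aE q0 mul0r.
apply/bigmax_leqP => i _.
have : p i = q * M`_i by apply: (mulfI b0); rewrite bp aE mulrA [b * q]mulrC.
have := lep i (ltn_ord i) => /[swap] ->.
have [->|m0] := eqVneq M`_i 0; first by rewrite size_poly0.
move=> le; rewrite -subn1 leq_subLR add1n; apply: leq_trans le.
by rewrite dvdp_leq ?mulf_neq0 // dvdp_mull.
Qed.

(** * The degree bound for the primitive LCLM *)

Theorem theorem4 (K : fieldType) (k : nat) (L : 'I_k -> {poly {poly K}})
  (M : {poly {poly K}}) :
  (forall i, L i != 0) ->
  is_lclm L M ->
  (degx M <= (\max_(i < k) degx (L i))%N *
              (k * ((\sum_(i < k) opord (L i))%N + 1) - \sum_(i < k) opord (L i)))%N.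
Proof.
move=> L0 [LCLM prim]; have [M0 clmM minM] := LCLM.
set s := (\sum_(i < k) _)%N; set d := (\max_(i < k) _)%N.
set r := opord (embop M).
have ler : (r <= s)%N.
  by have [W [W0 clmW leW]] := exists_clm L0; apply: leq_trans leW; apply: minM.
have leLr i : (opord (L i) <= r)%N by apply: opord_clm_ge.
(* The sharper bound in terms of the order [r] is the one proved below. *)
apply: (@leq_trans (d * (k * (r + 1) - s))); last first.
  by rewrite leq_mul2l leq_sub2r ?orbT // leq_mul2l leq_add2r ler orbT.
have [u0 [u0M u0Q]] := is_clm_multiple L0 M0 clmM; rewrite -/r in u0 u0M u0Q.
have u0ker : forall i, ratmul (left_factor u0 i) (embop (L i)) = multiple_of u0.
  by move=> i; rewrite u0M u0Q.
pose e (x : clm_unknown L r) := if x is inl _ then d else 0%N.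
have ker1 (u : clm_unknown L r -> {fraction {poly K}}) :
    (forall y, \sum_x u x * tofrac (clm_coef x y) = 0) ->
    exists c, forall x, u x = c * u0 x.
  move=> /(clm_system u L0) eqs.
  have [|||c cE] := @LCLM_unique K k L (embop M) (multiple_of u) => //.
  + by move=> i; exists (left_factor u i).
  + by rewrite (size_opord M0); apply: size_poly.
  (* The difference u - c u0 is a solution with W = 0, hence zero. *)
  exists c => x; apply/eqP; rewrite -subr_eq0; apply/eqP; move: x.
  have kerw y : \sum_x (u x - c * u0 x) * tofrac (clm_coef x y) = 0.
    transitivity (\sum_x u x * tofrac (clm_coef x y) -
                  c * \sum_x u0 x * tofrac (clm_coef x y)).
      by rewrite mulr_sumr -sumrB; apply: eq_bigr => x _; rewrite mulrBl mulrA.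
    have -> : \sum_x u x * tofrac (clm_coef x y) = 0 by move: y; apply/clm_system.
    have -> : \sum_x u0 x * tofrac (clm_coef x y) = 0 by move: y; apply/clm_system.
    by rewrite mulr0 subrr.
  apply: (@clm_system_inj _ _ L r (fun x => u x - c * u0 x)) => //.
    exact/clm_system.
  have -> : multiple_of (fun x => u x - c * u0 x) = multiple_of u - c *: multiple_of u0.
    rewrite /multiple_of -linearZ -linearB; congr rVpoly.
    by apply/rowP => j; rewrite !mxE.
  by rewrite cE u0M subrr.
have [||||v [[x vx] va lev]] := @poly_kernel K _ _ (@clm_coef K k L r) e u0.
- case=> [[i j]|m] [i' m'] /=; last by case: ifP; rewrite ?size_poly0 ?size_polyN ?size_poly1.
  case: ifP => [/eqP|]; last by rewrite size_poly0.
  move=> _; apply: size_coef_dpow => l; apply: (leq_trans (size_coef_degx _ _)).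
  by rewrite ltnS /d (leq_bigmax i').
(* This unknown holds the leading coefficient of M, as [r] is its exact order. *)
- exists (inr ord_max); apply: contraNneq M0 => u00.
  rewrite -lead_coef_eq0 lead_coefE -/(opord _) -/r -u0M.
  by have := coef_rVpoly_ord (\row_m u0 (inr m)) ord_max; rewrite mxE u00 => /eqP.
- exact/clm_system.
- exact: ker1.
have [c cE] : exists c, forall x, tofrac (v x) = c * u0 x.
  apply: ker1 => y.
  by rewrite -[RHS]tofrac0 -(va y) rmorph_sum; apply: eq_bigr => x' _; rewrite /= -tofracM.
have c0 : c != 0.
  by apply: contraNneq vx => c0; rewrite -tofrac_eq0 cE c0 mul0r.
have sM : size M = r.+1 by rewrite -size_embop size_opord.
apply: (@degx_primitive_le K M
  (* The default 0 agrees with the coefficients of M beyond \partial^r. *)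
  (fun i => if insub i is Some m then v (inr m) else 0) c) => //.
- move=> i; case: insubP => [m _ <-|].
    rewrite cE -coef_embop -u0M.
    by have := coef_rVpoly_ord (\row_m u0 (inr m)) m; rewrite mxE => ->.
  by rewrite -leqNgt => leri; rewrite nth_default ?sM // tofrac0 mulr0.
move=> i _; case: insubP => [m _ _|_]; last by rewrite size_poly0.
apply: (leq_trans (lev _)); rewrite ltnS.
(* Restoring the omitted row costs nothing: it belongs to W, where [e] is 0. *)
apply: (@leq_trans (\sum_z e z)); first by rewrite [leqRHS](bigID (fun z => z != inr m)) leq_addr.
by rewrite big_sumType /= big1_eq addn0 sum_nat_const card_clm_unknown // mulnC.
Qed.
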